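(* For all $1\le p,q\le\infty$ there exist constants $c_{p,q}>0$, depending only on $p,q$, such that for every integer $n\ge1$, with $K=B_p^n$ and $L=B_q^n$, $$\Gamma_n(K,L)\ge c_{p,q}\begin{cases} n^{1/2+1/p-1/q}, & \text{if } 2\le p,q\le\infty,\\ n^{1-1/q}, & \text{if }1\le p\le2.\end{cases}$$ Also, there are constants $c_{p,q,r}>0$, depending only on $p,q,r$, such that if $1<q\le2\le p<\infty$ and $r>\max\{p,q'\}$, where $1/q+1/q'=1$, then for every $n\ge1$ $$\Gamma_n(K,L)\ge c_{p,q,r}\,n^{1/r}.$$
   Context: $B_p^n$ is the unit ball of $\ell_p^n$, i.e. of $\mathbb{R}^n$ with the $\ell_p$ norm; $1/\infty=0$. A ball in $\mathbb{R}^m$ is a bounded, convex, symmetric set with nonempty interior; $\|\cdot\|_K$ is the norm with unit ball $K$. For balls $K,L\subset\mathbb{R}^m$ and $n\le m$, $\Gamma_n(K,L)=\inf\|A\|\,\|B\|$, where the infimum is over all $n$-dimensional subspaces $E\subset\mathbb{R}^m$ and all linear operators $B:(E,\|\cdot\|_{L\cap E})\to\ell_1^n$, $A:\ell_1^n\to(E,\|\cdot\|_{K\cap E})$ such that $AB=\mathrm{id}_E$ (operator norms with respect to the indicated norms). *)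

(* Defs.v *)
From HB Require Import structures.
From mathcomp Require Import all_boot all_order all_algebra.
From mathcomp Require Import all_classical all_reals all_analysis.

Set Implicit Arguments.
Unset Strict Implicit.
Unset Printing Implicit Defensive.

Import Order.TTheory GRing.Theory Num.Theory.

Local Open Scope classical_set_scope.
Local Open Scope ring_scope.

(* Exponents live in \bar R; the only non-real exponent of interest is +oo
   (-oo is given the same, irrelevant, value). *)
Definition lpnorm (R : realType) (n : nat) (p : \bar R) (x : 'rV[R]_n) : R :=
  match p with
  | EFin p => (\sum_(i < n) `|x ord0 i| `^ p) `^ p^-1
  | _ => \big[Num.max/0]_(i < n) `|x ord0 i|
  end.

Definition lpball (R : realType) (n : nat) (p : \bar R) : set 'rV[R]_n :=
  [set x | lpnorm p x <= 1].

(* The norm with unit ball K, i.e. the Minkowski functional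
   inf {t > 0 | x \in t K}. *)
Definition ballnorm (R : realType) (V : lmodType R) (K : set V) (x : V) : R :=
  inf [set t : R | 0 < t /\ [set t *: y | y in K] x].

Definition opnorm (R : realType) (U V : lmodType R) (nu : U -> R) (mu : V -> R)
    (f : U -> V) : \bar R :=
  ereal_sup [set (mu (f x))%:E | x in [set x | nu x <= 1]].

(* (E, || ||_(K :&: E)): the section of K by E, seen as a subset of E. *)
Definition sectionnorm (R : realType) (m : nat) (K : set 'rV[R]_m)
    (E : {vspace 'rV[R]_m}) (x : subvs_of E) : R :=
  ballnorm (vsval @^-1` K) x.

(* Meaningful when K and L are balls of R^m and n <= m; the operator norms are
   then real numbers. *)
Definition Gamma (R : realType) (m n : nat) (K L : set 'rV[R]_m) : \bar R :=
  ereal_inf [set y | exists (E : {vspace 'rV[R]_m})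
      (B : 'Hom(subvs_of E, 'rV[R]_n)) (A : 'Hom('rV[R]_n, subvs_of E)),
    [/\ \dim E = n,
        (A \o B)%VF = \1%VF
      & y = (opnorm (@lpnorm R n 1%:E) (@sectionnorm R m K E) A *
             opnorm (@sectionnorm R m L E) (@lpnorm R n 1%:E) B)%E]].

(* Main.v *)
(** All factorizations are of the identity of R^n, i.e. pairs of matrices with
    Q P = 1. For the first two bounds, n = tr (Q P) is at most the sum of the
    products of Euclidean norms of the columns of Q and the rows of P, and by
    Khinchin's inequality some sign vector is mapped by Q to a vector whose l_1
    norm controls the sum of the column norms.
    For the third bound, let s be the conjugate exponent of q. The transpose of
    Q is an operator from l_oo to l_s; it is (s,1)-summing, hence by Pisier's
    factorization argument dominated by an L_(s,1) norm of a measure, hence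
    r-summing for every r > s, with constants independent of n. Evaluating on
    the rows of the transpose of P, which it maps to the unit vectors, bounds n. *)

Require Import Defs.
From HB Require Import structures.
From mathcomp Require Import all_boot all_order all_algebra.
From mathcomp Require Import all_classical all_reals all_analysis.
From mathcomp Require Import ring lra.
Import Order.TTheory GRing.Theory Num.Theory.
Local Open Scope classical_set_scope.
Local Open Scope ring_scope.

(** * Convexity inequalities for real powers *)

Section PowerInequalities.
Variable R : realType.
Implicit Types a b s t u v : R.

Lemma powRV u s : 0 <= u -> u^-1 `^ s = (u `^ s)^-1.
Proof.
by move=> u0; rewrite -powR_inv1// powRAC powR_inv1 ?powR_ge0.
Qed.

Lemma powR_gt1 u s : 1 < u -> 0 < s -> 1 < u `^ s.
Proof.
move=> u1 s0; have e1 : 1 `^ s = 1 :> R by rewrite powR1.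
by rewrite -[X in X < _]e1 gt0_ltr_powR ?nnegrE//; lra.
Qed.

(** Young's inequality with exponents s/(s-1) and s, that is, the tangent at [u] to the convex
    function v^s. The case s = 1 is separate because s/(s-1) degenerates. *)
Lemma powR_tangent s u v : 1 <= s -> 0 <= u -> 0 <= v ->
  s * (u `^ (s - 1) * v) <= (s - 1) * u `^ s + v `^ s.
Proof.
rewrite le_eqVlt => /predU1P[<- _ v0|s1 u0 v0].
  by rewrite subrr powRr0 mul0r add0r !mul1r powRr1.
have s0 : 0 < s by lra.
have d0 : 0 < s - 1 by lra.
have := @conjugate_powR R (u `^ (s - 1)) v (s / (s - 1)) s (powR_ge0 _ _) v0.
rewrite -powRrM.
have -> : (s - 1) * (s / (s - 1)) = s by field; rewrite gt_eqF.
have -> : (s / (s - 1))^-1 + s^-1 = 1 by field; rewrite !gt_eqF.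
move=> /(_ (divr_gt0 s0 d0) s0 erefl) H.
have := ler_wpM2l (ltW s0) H; congr (_ <= _).
by field; rewrite !gt_eqF.
Qed.

(** The tangent inequality between |a| and |a - b|, since |a| - sg(a) b = sg(a) (a - b) is at most
    |a - b|. *)
Lemma norm_powR_tangent s a b : 1 <= s ->
  `|a| `^ s - s * (`|a| `^ (s - 1) * Num.sg a * b) <= `|a - b| `^ s.
Proof.
move=> s1; have s0 : 0 < s by lra.
have H := powR_tangent s `|a| `|a - b| s1 (normr_ge0 _) (normr_ge0 _).
suff : s * (`|a| `^ s - `|a| `^ (s - 1) * Num.sg a * b)
    <= s * (`|a| `^ (s - 1) * `|a - b|) by lra.
rewrite ler_pM2l// -(mulr_powRB1 (normr_ge0 a) s0) mulrC -mulrA -mulrBr.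
rewrite ler_wpM2l ?powR_ge0//.
rewrite [X in X - _]normrEsg -mulrBr (le_trans (ler_norm _))// normrM.
by rewrite ler_piMl// normr_sg lern1 leq_b1.
Qed.

Lemma powR_superadditive s u v : 1 <= s -> 0 <= u -> 0 <= v ->
  u `^ s + v `^ s <= (u + v) `^ s.
Proof.
move=> s1 u0 v0; have s0 : 0 < s by lra.
have uv0 : 0 <= u + v by lra.
rewrite -(mulr_powRB1 u0 s0) -(mulr_powRB1 v0 s0) -(mulr_powRB1 uv0 s0) mulrDl.
by apply: lerD; rewrite ler_wpM2l// ge0_ler_powR ?nnegrE//; lra.
Qed.

Lemma powR_sqr a s : `|a| `^ s = (a ^+ 2) `^ (s / 2).
Proof.
by rewrite -real_normK ?num_real// -powR_mulrn// -powRrM mulrCA divff ?mulr1.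
Qed.

(** With k = s/2, the mean of (a + b)^2 and (a - b)^2 is w = a^2 + b^2. Convexity of the k-th power
    bounds the right side below by 2 w^k, and superadditivity bounds w^k below. *)
Lemma clarkson_powR s a b : 2 <= s ->
  2 * (`|a| `^ s + `|b| `^ s) <= `|a + b| `^ s + `|a - b| `^ s.
Proof.
move=> s2; rewrite !(powR_sqr _ s); set k := s / 2.
have k1 : 1 <= k by rewrite /k; lra.
have k0 : 0 < k by lra.
set w := a ^+ 2 + b ^+ 2.
have w0 : 0 <= w by rewrite addr_ge0 ?sqr_ge0.
have H1 := powR_superadditive k (a ^+ 2) (b ^+ 2) k1 (sqr_ge0 _) (sqr_ge0 _).
have H2 := powR_tangent k w ((a + b) ^+ 2) k1 w0 (sqr_ge0 _).
have H3 := powR_tangent k w ((a - b) ^+ 2) k1 w0 (sqr_ge0 _).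
have H4 := mulr_powRB1 w0 k0.
rewrite -/w in H1.
have H5 : k * (w `^ (k - 1) * (a + b) ^+ 2) + k * (w `^ (k - 1) * (a - b) ^+ 2)
   = 2 * (k * (w `^ k)) by rewrite -H4 {3}/w; ring.
lra.
Qed.

(** Jensen's inequality for |a| + |b| = (1 - th) (|a|/(1 - th)) + th (|b|/th), where the weight [th]
    solves th^(1-s) = c. The point is that [c] may be arbitrarily close to 1. *)
Lemma powR_norm_addr s c : 1 < s -> 1 < c -> exists2 d, 0 <= d &
  forall a b, `|a + b| `^ s <= d * `|a| `^ s + c * `|b| `^ s.
Proof.
move=> s1 c1; have s0 : 0 < s by lra.
pose th := c `^ (- (s - 1)^-1).
have th0 : 0 < th by rewrite powR_gt0; lra.
have th1 : th < 1.
  have : 1 < c `^ (s - 1)^-1 by rewrite powR_gt1// invr_gt0; lra.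
  by move=> H; rewrite /th powRN invf_lt1//; apply: lt_trans H.
have thc : th * (th^-1) `^ s = c.
  rewrite powRV ?(ltW th0)// -powRN -{1}(@powRr1 _ th) ?ltW//.
  rewrite -powRD ?(gt_eqF th0) ?implybT//.
  rewrite -powRrM.
  have -> : - (s - 1)^-1 * (1 - s) = 1 by field; apply/eqP; lra.
  by rewrite powRr1//; lra.
have t10 : 0 < 1 - th by lra.
pose d := (1 - th) * (1 - th)^-1 `^ s.
exists d; first by rewrite mulr_ge0 ?powR_ge0 ?ltW.
move=> a b; pose w := `|a| + `|b|.
have w0 : 0 <= w by rewrite addr_ge0.
rewrite -thc -!mulrA -!powRM ?invr_ge0 ?(ltW th0) ?(ltW t10)//.
apply: (@le_trans _ _ (w `^ s)).
  by rewrite ge0_ler_powR ?nnegrE// ?ler_normD//; lra.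
have x0 : 0 <= (1 - th)^-1 * `|a| by rewrite mulr_ge0 ?invr_ge0 ?(ltW t10) ?(ltW th0).
have y0 : 0 <= th^-1 * `|b| by rewrite mulr_ge0 ?invr_ge0 ?(ltW t10) ?(ltW th0).
have H1 := ler_wpM2l (ltW t10) (powR_tangent s w _ (ltW s1) w0 x0).
have H2 := ler_wpM2l (ltW th0) (powR_tangent s w _ (ltW s1) w0 y0).
have H4 := mulr_powRB1 w0 s0.
have H5 : (1 - th) * (s * (w `^ (s - 1) * ((1 - th)^-1 * `|a|))) +
   th * (s * (w `^ (s - 1) * (th^-1 * `|b|))) = s * w `^ s.
  by rewrite -H4 {3}/w; field; rewrite !gt_eqF.
lra.
Qed.

(* The quartic minorant turns a lower bound for an absolute first moment into
   bounds for the second and fourth moments. *)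
Lemma norm_ge_quartic t s : 0 <= s ->
  3 / 4 * (t ^+ 2 / s) - t ^+ 4 / (16 * s ^+ 3) <= `|t|.
Proof.
rewrite le_eqVlt => /predU1P[<-|s0]; first by rewrite expr0n/= !(mulr0, invr0) subr0.
have -> : t ^+ 4 = `|t| ^+ 4 by rewrite -normrX ger0_norm// exprn_even_ge0.
have -> : t ^+ 2 = `|t| ^+ 2 by rewrite -normrX ger0_norm// exprn_even_ge0.
have [u u0 ->] : exists2 u, 0 <= u & `|t| = 2 * u * s.
  by exists (`|t| / (2 * s)); [rewrite divr_ge0//; lra | field; rewrite gt_eqF].
have -> : 3 / 4 * ((2 * u * s) ^+ 2 / s) - (2 * u * s) ^+ 4 / (16 * s ^+ 3)
  = s * (3 * u ^+ 2 - u ^+ 4) by field; rewrite gt_eqF.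
have u2 : 0 <= u + 2 by lra.
(* In the variable u = |t|/(2s) the claim is 3u^2 - u^4 <= 2u, and u^4 - 3u^2 + 2u = u (u - 1)^2 (u
   + 2). *)
have := mulr_ge0 (ltW s0) (mulr_ge0 u0 (mulr_ge0 (sqr_ge0 (u - 1)) u2)).
by nra.
Qed.

End PowerInequalities.

(** * (s,1)-summing operators on l_oo and Pisier's dominating measure *)

Section PisierDomination.
Variables (R : realType) (m n : nat) (s : R).
Hypothesis s2 : 2 <= s.
Implicit Types (M : 'M[R]_(m, n)) (x y z : 'rV[R]_m) (l : seq 'rV[R]_m).

Definition powsum {k} (v : 'rV[R]_k) : R := \sum_(j < k) `|v ord0 j| `^ s.

Lemma powsum_ge0 k (v : 'rV[R]_k) : 0 <= powsum v.
Proof. by apply: sumr_ge0 => j _; exact: powR_ge0. Qed.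

Lemma powsum0 k : powsum (0 : 'rV[R]_k) = 0.
Proof.
rewrite /powsum big1// => j _; rewrite mxE normr0 powR0//.
by rewrite gt_eqF// (lt_le_trans _ s2).
Qed.

Lemma powsumZ k a (v : 'rV[R]_k) : powsum (a *: v) = `|a| `^ s * powsum v.
Proof.
by rewrite /powsum mulr_sumr; apply: eq_bigr => j _; rewrite mxE normrM powRM.
Qed.

(** Greedy choice of signs: by Clarkson's inequality one of y + x and y - x gains at least the power
    sum of x M. The vector [y] accumulates the terms already signed. *)
Lemma exists_signed_sum M l y : exists2 z : 'rV[R]_m,
  forall i, `|z ord0 i| <= \sum_(x <- l) `|x ord0 i| &
  \sum_(x <- l) powsum (x *m M) + powsum (y *m M) <= powsum ((y + z) *m M).
Proof.
elim: l y => [|x l IH] y.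
  exists 0 => [i|]; first by rewrite big_nil mxE normr0.
  by rewrite big_nil add0r addr0.
have H : 2 * (powsum (y *m M) + powsum (x *m M)) <=
    powsum ((y + x) *m M) + powsum ((y - x) *m M).
  rewrite -!big_split/= mulr_sumr; apply: ler_sum => j _.
  by rewrite mulmxDl mulmxBl !mxE clarkson_powR.
have [H1|H1] : powsum (y *m M) + powsum (x *m M) <= powsum ((y + x) *m M)
    \/ powsum (y *m M) + powsum (x *m M) <= powsum ((y - x) *m M).
  by case: (leP (powsum (y *m M) + powsum (x *m M)) (powsum ((y + x) *m M)));
    [left | right]; lra.
- have [z z1 z2] := IH (y + x); exists (x + z) => [i|].
    by rewrite big_cons mxE (le_trans (ler_normD _ _))// lerD2l.
  by rewrite big_cons addrA; lra.
- have [z z1 z2] := IH (y - x); exists (z - x) => [i|].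
    by rewrite big_cons !mxE (le_trans (ler_normB _ _))// addrC lerD2l.
  rewrite big_cons; have -> : y + (z - x) = y - x + z by rewrite addrCA addrC.
  by lra.
Qed.

Definition norm_le1 (z : 'rV[R]_m) := forall i, `|z ord0 i| <= 1.

(** In l_oo this says that the weak l_1 norm of the family is at most 1. *)
Definition sum_norm_le1 (l : seq 'rV[R]_m) := forall i, \sum_(x <- l) `|x ord0 i| <= 1.

(** A signed sum of an admissible family lies in the unit ball of l_oo, where [W] bounds the power
    sum. *)
Lemma summing_s1 M W l : (forall z, norm_le1 z -> powsum (z *m M) <= W) ->
  sum_norm_le1 l -> \sum_(x <- l) powsum (x *m M) <= W.
Proof.
move=> MW l1; have [z z1] := exists_signed_sum M l 0.
rewrite mul0mx powsum0 addr0 add0r => /le_trans; apply; apply: MW => i.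
exact: le_trans (z1 i) (l1 i).
Qed.

Definition pointwise_mul (f : 'I_m -> R) x : 'rV[R]_m :=
  \row_i (f i * x ord0 i).

(* Pisier's argument: a family nearly maximizing the (s,1)-summing functional
   stays admissible when each x in it is replaced by (1 - |z|) x and z is
   added; the first-order loss is then the value at |z| of a linear functional,
   which must dominate the gain powsum (z *m M). *)
Lemma pisier_domination M W e : 0 < e ->
  (forall z, norm_le1 z -> powsum (z *m M) <= W) ->
  exists mu : 'I_m -> R, [/\ forall i, 0 <= mu i, \sum_i mu i <= W &
    forall z, norm_le1 z ->
      powsum (z *m M) <= e + s * \sum_i mu i * `|z ord0 i|].
Proof.
move=> e0 MW; have s1 : 1 <= s by move: s2; lra.
have s0 : 0 < s by lra.
pose F l := \sum_(x <- l) powsum (x *m M).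
pose S := [set F l | l in sum_norm_le1].
have SW l : sum_norm_le1 l -> F l <= W by exact: summing_s1.
have supS : has_sup S.
  split; first by exists (F [::]), [::] => // i; rewrite big_nil.
  by exists W => _ [l l1 <-]; exact: SW.
have [_ [l l1 <-] supl] := sup_adherent e0 supS.
(* Here s times [g x j] is the derivative of |.|^s at entry j of x M, so s times [lam] is the
   gradient of [F] with respect to coordinate multipliers applied to [l]. *)
pose g x j := `|(x *m M) ord0 j| `^ (s - 1) * Num.sg ((x *m M) ord0 j).
pose lam i := \sum_(x <- l) \sum_j g x j * (x ord0 i * M i j).
have lamE f : \sum_i f i * lam i =
    \sum_(x <- l) \sum_j g x j * (pointwise_mul f x *m M) ord0 j.
  rewrite /lam; under eq_bigr do rewrite mulr_sumr.
  rewrite exchange_big/=; apply: eq_bigr => x _.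
  under eq_bigr do rewrite mulr_sumr.
  rewrite exchange_big/=; apply: eq_bigr => j _.
  rewrite mxE mulr_sumr; apply: eq_bigr => i _; rewrite mxE; ring.
have admissible f : (forall i, `|f i| <= 1) ->
    sum_norm_le1 [seq pointwise_mul f x | x <- l].
  move=> f1 i; rewrite big_map; apply: le_trans (l1 i).
  by apply: ler_sum => x _; rewrite mxE normrM ler_piMl.
exists (fun i => `|lam i|); split => // [|z z1].
  (* Multiplying by the signs of [lam] keeps the family admissible, and the tangent inequality then
     bounds s times the total mass by (s - 1) W + W. *)
  pose f i := Num.sg (lam i).
  have f1 i : `|f i| <= 1 by rewrite normr_sg lern1 leq_b1.
  rewrite (eq_bigr (fun i => f i * lam i)); last by move=> i _; rewrite -normrEsg.
  suff : s * (\sum_i f i * lam i) <= (s - 1) * W + W.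
    by rewrite (_ : _ + W = s * W) ?ler_pM2l//; ring.
  apply: (@le_trans _ _ ((s - 1) * F l + F [seq pointwise_mul f x | x <- l])).
    rewrite lamE /F big_map !mulr_sumr -big_split/=; apply: ler_sum => x _.
    rewrite /powsum !mulr_sumr -big_split/=; apply: ler_sum => j _.
    apply: le_trans (powR_tangent _ _ _ _ s1 (normr_ge0 _) (normr_ge0 _)).
    rewrite ler_pM2l// /g -mulrA ler_wpM2l ?powR_ge0//.
    by rewrite (le_trans (ler_norm _))// normrM ler_piMl// normr_sg lern1 leq_b1.
  by apply: lerD; [apply: ler_wpM2l; [lra | exact: SW] | apply/SW/admissible].
pose f i := `|z ord0 i|.
pose l' := z :: [seq pointwise_mul (fun i => 1 - f i) x | x <- l].
(* Coordinatewise, |z| + (1 - |z|) times a sum that is at most 1. *)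
have l'1 : sum_norm_le1 l'.
  move=> i; rewrite big_cons big_map -lerBrDl.
  have f1 : 0 <= 1 - f i by have := z1 i; rewrite /f; lra.
  rewrite (eq_bigr (fun x => (1 - f i) * `|x ord0 i|)) => [|x _].
    by rewrite -mulr_sumr ler_piMr.
  by rewrite mxE normrM ger0_norm.
have : F l' <= sup S by apply: ub_le_sup; [exact: supS.2 | exists l'].
rewrite {1}/F big_cons big_map => Hl'.
have : F l - s * (\sum_i f i * lam i) <=
    \sum_(x <- l) powsum (pointwise_mul (fun i => 1 - f i) x *m M).
  rewrite lamE /F mulr_sumr -sumrB; apply: ler_sum => x _.
  rewrite /powsum mulr_sumr -sumrB; apply: ler_sum => j _.
  have -> : pointwise_mul (fun i => 1 - f i) x = x - pointwise_mul f x.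
    by apply/rowP => i; rewrite !mxE; ring.
  rewrite mulmxBl /g; move: (x *m M) (pointwise_mul f x *m M) => u v.
  by rewrite !mxE norm_powR_tangent.
have : s * (\sum_i f i * lam i) <= s * (\sum_i `|lam i| * `|z ord0 i|).
  rewrite ler_pM2l//; apply: ler_sum => i _.
  by rewrite mulrC; apply: ler_wpM2r; [exact: normr_ge0 | exact: ler_norm].
lra.
Qed.

End PisierDomination.

Arguments powsum {R} s {k} v.
Arguments norm_le1 {R m} z.

(** * From domination to r-summing bounds, uniformly in the dimension *)

Section SummingOperators.
Variables (R : realType) (s r : R).
Hypotheses (s2 : 2 <= s) (sr : s < r).

(* The condition on [h] makes [powsum (h *m M)] comparable with [mu]-integrals
   of [`|h| `^ r]; the bound propagates from the band 1 <= |h| < 2 to all larger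
   values since replacing h by h / 2 costs 2^s on the left and gains 2^r. *)
Lemma powsum_domination : exists2 K : R, 0 < K &
  forall (m n : nat) (M : 'M[R]_(m, n)) (W : R), 0 < W ->
    (forall z, norm_le1 z -> powsum s (z *m M) <= W) ->
  exists mu : 'I_m -> R, [/\ forall i, 0 <= mu i, \sum_i mu i <= 2 * W &
    forall h : 'rV[R]_m, (forall i, h ord0 i = 0 \/ 1 <= `|h ord0 i|) ->
      powsum s (h *m M) <= K * \sum_i mu i * `|h ord0 i| `^ r].
Proof.
have s0 : 0 < s by move: s2; lra.
have s1 : 1 < s by move: s2; lra.
have r1 : 1 <= r by move: sr; lra.
have r0 : r != 0 by rewrite gt_eqF//; lra.
have c1 : 1 < 2 `^ (r - s) :> R by rewrite powR_gt1 ?subr_gt0 ?ltr1n.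
(* The splitting cost 2^(r-s) times the halving cost 2^s is exactly the 2^r regained on the right,
   so the same [K] survives the induction. *)
have [d0 _ dP] := powR_norm_addr R s (2 `^ (r - s)) s1 c1.
pose d := d0 + 1.
have d_gt0 : 0 < d.
  have := dP 1 0; rewrite addr0 normr1 normr0 powR0 ?gt_eqF// powR1 /d; lra.
pose K := d * (s * 2 `^ s).
have p2s : 0 < 2 `^ s :> R by rewrite powR_gt0.
exists K; first by rewrite !mulr_gt0.
move=> m n M W W0 MW.
(* Adding [e] to each of the m weights adds at most [W] to the mass; this is what absorbs the
   additive error [e]. *)
pose e := W / m.+1%:R.
have e0 : 0 < e by rewrite divr_gt0 ?ltr0n.
have [mu [mu0 muW muP]] := pisier_domination R m n s s2 M W e e0 MW.
have nu0 i : 0 <= mu i + e by rewrite addr_ge0 // ltW.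
have nuh0 (h : 'rV[R]_m) i : 0 <= (mu i + e) * `|h ord0 i| `^ r.
  by rewrite mulr_ge0 ?powR_ge0.
exists (fun i => mu i + e); split => //.
  rewrite big_split/= sumr_const card_ord -mulr_natr.
  suff : e * m%:R <= W by lra.
  by rewrite /e mulrAC ler_pdivrMr ?ltr0n// ler_wpM2l ?ler_nat ?ltW.
have band (h : 'rV[R]_m) : (forall i, h ord0 i = 0 \/ 1 <= `|h ord0 i| <= 2) ->
    powsum s (h *m M) <= s * 2 `^ s * \sum_i (mu i + e) * `|h ord0 i| `^ r.
  move=> h12; have [->|/rV0Pn[i0 hi0]] := eqVneq h 0.
    by rewrite mul0mx powsum0// mulr_ge0 ?sumr_ge0// ltW// mulr_gt0.
  have z1 : norm_le1 (2^-1 *: h).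
    move=> i; rewrite mxE normrM gtr0_norm ?invr_gt0//.
    by case: (h12 i) => [->|/andP[]]; rewrite ?normr0; lra.
  have := muP _ z1; rewrite -scalemxAl powsumZ.
  have -> : `|2^-1 : R| `^ s = (2 `^ s)^-1.
    by rewrite gtr0_norm ?invr_gt0// powRV.
  rewrite ler_pdivrMl// => /le_trans; apply.
  rewrite mulrAC mulrC ler_pM2r//.
  have h0 : 1 <= `|h ord0 i0|.
    by case: (h12 i0) => [h0|/andP[]//]; move: hi0; rewrite (ord1 _) h0 eqxx.
  have hr i : `|h ord0 i| <= `|h ord0 i| `^ r.
    case: (h12 i) => [->|/andP[h1 _]]; first by rewrite normr0 powR0.
    exact: le1r_powR.
  (* A nonzero [h] has a coordinate with |h| >= 1, and s >= 2 compensates the factor 1/2. *)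
  have e_le : e <= s * \sum_i e * (2^-1 * `|h ord0 i|).
    rewrite (bigD1 i0)//= mulrDr -[X in X <= _]addr0 lerD//.
      have sh : 2 <= s * `|h ord0 i0| by rewrite -[X in X <= _]mulr1 ler_pM.
      rewrite (_ : s * _ = e * (s * `|h ord0 i0| / 2)); last by ring.
      by rewrite ler_peMr ?(ltW e0)//; lra.
    rewrite mulr_ge0 ?(ltW s0)// sumr_ge0// => i _.
    by apply: mulr_ge0; [exact: ltW | rewrite mulr_ge0 ?invr_ge0].
  apply: (@le_trans _ _ (s * \sum_i (mu i + e) * (2^-1 * `|h ord0 i|))).
    under [X in _ <= _ * X]eq_bigr do rewrite mulrDl.
    rewrite big_split/= mulrDr addrC lerD// ler_pM2l// ler_sum// => i _.
    by rewrite mxE normrM gtr0_norm ?invr_gt0.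
  rewrite ler_pM2l// ler_sum// => i _; rewrite ler_wpM2l//.
  by have := hr i; have := normr_ge0 (h ord0 i); lra.
suff H L (h : 'rV[R]_m) : (forall i, h ord0 i = 0 \/ 1 <= `|h ord0 i|) ->
    (forall i, `|h ord0 i| < 2 ^+ L) ->
    powsum s (h *m M) <= K * \sum_i (mu i + e) * `|h ord0 i| `^ r.
  move=> h h1; pose B := \sum_i `|h ord0 i|.
  have [L BL] : exists L, B < 2 ^+ L.
    exists (Num.bound B); apply: lt_le_trans (archi_boundP _) _.
      by rewrite sumr_ge0.
    by rewrite -natrX ler_nat ltnW// ltn_expl.
  apply: (H L) => // i; apply: le_lt_trans BL.
  by rewrite /B (bigD1 i)//= lerDl sumr_ge0.
elim: L h => [|L IH] h h1 hL.
  have -> : h = 0.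
    apply/rowP => i; rewrite mxE; case: (h1 i) => // hi.
    by have := hL i; rewrite expr0; lra.
  by rewrite mul0mx powsum0// mulr_ge0 ?sumr_ge0// ltW// !mulr_gt0.
(* [lo] keeps the entries in the band; [hi] halves the others, so its nonzero entries are still at
   least 1 and now lie below 2^L. *)
pose lo : 'rV[R]_m := \row_i (if `|h ord0 i| < 2 then h ord0 i else 0).
pose hi : 'rV[R]_m := 2^-1 *: (\row_i (if `|h ord0 i| < 2 then 0 else h ord0 i)).
have hE : h = lo + 2 *: hi.
  rewrite scalerA divff// scale1r; apply/rowP => i; rewrite !mxE.
  by case: ifP => _; rewrite ?addr0 ?add0r.
have lo_le : powsum s (lo *m M) <=
    s * 2 `^ s * \sum_i (mu i + e) * `|lo ord0 i| `^ r.
  apply: band => i; rewrite mxE; case: ifP => [h2|_]; last by left.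
  by case: (h1 i); [left | right; rewrite (ltW h2) andbT].
have hi_le : powsum s (hi *m M) <= K * \sum_i (mu i + e) * `|hi ord0 i| `^ r.
  apply: IH => i; rewrite !mxE; case: (ltP `|h ord0 i| 2) => h2.
  - by left; rewrite mulr0.
  - by right; rewrite normrM gtr0_norm ?invr_gt0//; lra.
  - by rewrite mulr0 normr0 exprn_gt0.
  - rewrite normrM gtr0_norm ?invr_gt0//; have := hL i; rewrite exprS; lra.
have split_le : powsum s (h *m M) <=
    d * powsum s (lo *m M) + 2 `^ (r - s) * powsum s (2 *: hi *m M).
  rewrite {1}hE mulmxDl /powsum !mulr_sumr -big_split/= ler_sum// => j _.
  move: (lo *m M) (2 *: hi *m M) => u v; rewrite mxE (le_trans (dP _ _))//.
  by rewrite lerD2r ler_wpM2r ?powR_ge0// /d lerDl.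
apply: le_trans split_le _.
rewrite -scalemxAl powsumZ [`|2|]gtr0_norm// mulrA -powRD ?pnatr_eq0 ?implybT//.
rewrite subrK.
apply: (@le_trans _ _ (d * (s * 2 `^ s * \sum_i (mu i + e) * `|lo ord0 i| `^ r)
  + 2 `^ r * (K * \sum_i (mu i + e) * `|hi ord0 i| `^ r))).
  by apply: lerD; rewrite ler_wpM2l ?powR_ge0 ?(ltW d_gt0).
rewrite mulrA -/K mulrCA -mulrDr ler_pM2l ?mulr_gt0// mulr_sumr -big_split/=.
apply: ler_sum => i _; rewrite mulrCA -mulrDr ler_wpM2l// !mxE.
rewrite normrM gtr0_norm ?invr_gt0// powRM ?invr_ge0// mulrA -powRM ?invr_ge0//.
rewrite divff// powR1 mul1r.
by case: ifP => _; rewrite ?normr0 powR0 ?addr0 ?add0r.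
Qed.

(* The identity factors through an operator into l_s, so its r-summing constant
   n^(1/r) is controlled by the norms of the factors. *)
Lemma summing_identity : exists2 C : R, 0 < C &
  forall (n : nat) (M P : 'M[R]_n) (D a : R), 0 < D -> 0 <= a ->
    P *m M = 1%:M ->
    (forall z, norm_le1 z -> powsum s (z *m M) <= D `^ s) ->
    (forall i, \sum_k `|P k i| `^ r <= a `^ r) ->
    n%:R <= C * (a * D) `^ r.
Proof.
have s0 : 0 < s by move: s2; lra.
have s1 : 1 < s by move: s2; lra.
have r0 : 0 < r by move: sr; lra.
have [K K0 KP] := powsum_domination.
have lt12 : 1 < 2 :> R by lra.
have [d d0 dP] := powR_norm_addr R s 2 s1 lt12.
(* Chosen so that t = q/D gives t^s D^s = 1/4: the small entries of a row then contribute at most 2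
   (1/4) = 1/2, half of the value 1 to be bounded. *)
pose q := 4 `^ (- s^-1) : R.
have q0 : 0 < q by rewrite powR_gt0.
exists (4 * (d + 1) * K * q `^ (s - r)).
  by rewrite !mulr_gt0 ?powR_gt0//; lra.
move=> n M P D a D0 a0 PM MD Pa.
have DsD : 0 < D `^ s by rewrite powR_gt0.
have [mu [mu0 muD muP]] := KP n n M (D `^ s) DsD MD.
pose t := q / D.
have t0 : 0 < t by rewrite divr_gt0.
have tDs : t `^ s * D `^ s = 4^-1.
  rewrite -powRM ?ltW// divfK ?gt_eqF// -powRrM mulNr mulVf ?gt_eqF//.
  by rewrite powR_inv1.
have row_le k : 1 <= 2 * (d + 1) * (t `^ (s - r) * (K *
    \sum_i mu i * `|P k i| `^ r)).
  (* Truncation at height [t]; dividing the large entries by [t] makes [h] admissible for the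
     domination. *)
  pose lo : 'rV[R]_n := \row_i (if `|P k i| < t then P k i else 0).
  pose h : 'rV[R]_n := \row_i (if `|P k i| < t then 0 else t^-1 * P k i).
  have rowE : row k P = t *: h + lo.
    apply/rowP => i; rewrite !mxE; case: ifP => _; first by rewrite mulr0 add0r.
    by rewrite addr0 mulrA divff ?mul1r ?gt_eqF.
  have lo_le : powsum s (lo *m M) <= 4^-1.
    have -> : lo = t *: (t^-1 *: lo) by rewrite scalerA divff ?gt_eqF ?scale1r.
    rewrite -scalemxAl powsumZ gtr0_norm// -tDs ler_wpM2l ?powR_ge0//.
    apply: MD => i; rewrite !mxE normrM gtr0_norm ?invr_gt0// ler_pdivrMl// mulr1.
    by case: ifP => [/ltW//|_]; rewrite normr0 ltW.
  have h_le : powsum s (h *m M) <= K * \sum_i mu i * (t `^ (- r) * `|P k i| `^ r).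
    apply: le_trans (muP h _) _ => [i|].
      rewrite mxE; case: (ltP `|P k i| t) => ht; [by left | right].
      by rewrite normrM gtr0_norm ?invr_gt0// ler_pdivlMl// mulr1.
    rewrite ler_pM2l// ler_sum// => i _; rewrite ler_wpM2l// mxE; case: ifP => _.
      by rewrite normr0 powR0 ?gt_eqF// mulr_ge0 ?powR_ge0.
    by rewrite normrM gtr0_norm ?invr_gt0// powRM ?invr_ge0 ?powRV ?(ltW t0)// powRN.
  have : powsum s (row k P *m M) <=
      d * (t `^ s * powsum s (h *m M)) + 2 * powsum s (lo *m M).
    have -> : t `^ s * powsum s (h *m M) = powsum s (t *: h *m M).
      by rewrite -scalemxAl powsumZ gtr0_norm.
    rewrite rowE mulmxDl /powsum !mulr_sumr -big_split/= ler_sum// => j _.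
    by move: (lo *m M) (t *: h *m M) => u v; rewrite mxE.
  have -> : powsum s (row k P *m M) = 1.
    rewrite -row_mul PM /powsum (bigD1 k)//= big1 => [|j jk].
      by rewrite !mxE eqxx normr1 powR1 addr0.
    by rewrite !mxE eq_sym (negPf jk) normr0 powR0 ?gt_eqF.
  have -> : t `^ (s - r) * (K * \sum_i mu i * `|P k i| `^ r) =
      t `^ s * (K * \sum_i mu i * (t `^ (- r) * `|P k i| `^ r)).
    rewrite powRD ?(gt_eqF t0) ?implybT// !mulr_sumr; apply: eq_bigr => i _; ring.
  have := ler_wpM2l (powR_ge0 t s) h_le.
  have := mulr_ge0 (powR_ge0 t s) (powsum_ge0 R s n (h *m M)).
  move: (t `^ s * powsum s (h *m M)) => x; move: (t `^ s * _) => y x0 xy H.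
  have : d * x <= d * y by rewrite ler_wpM2l.
  lra.
have : \sum_(k < n) (1 : R) <= \sum_(k < n) 2 * (d + 1) * (t `^ (s - r) * (K *
    \sum_i mu i * `|P k i| `^ r)) by exact: ler_sum.
rewrite sumr_const card_ord -!mulr_sumr exchange_big/= => /le_trans; apply.
(* The r-th powers in each column of [P] sum to at most a^r, and [mu] has mass at most 2 D^s. *)
have mu_le : \sum_i \sum_k mu i * `|P k i| `^ r <= 2 * D `^ s * a `^ r.
  apply: (@le_trans _ _ (\sum_i mu i * a `^ r)).
    by apply: ler_sum => i _; rewrite -mulr_sumr ler_wpM2l.
  by rewrite -mulr_suml ler_wpM2r ?powR_ge0.
have tE : t `^ (s - r) = q `^ (s - r) * D `^ (r - s).
  by rewrite powRM ?invr_ge0 ?powRV ?(ltW q0) ?(ltW D0)// -powRN opprB.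
have -> : 4 * (d + 1) * K * q `^ (s - r) * (a * D) `^ r =
    2 * (d + 1) * (t `^ (s - r) * (K * (2 * D `^ s * a `^ r))).
  rewrite tE powRM ?(ltW D0)//.
  have -> : D `^ r = D `^ (r - s) * D `^ s.
    by rewrite -powRD ?(gt_eqF D0) ?implybT// subrK.
  ring.
have d1 : 0 <= 2 * (d + 1) by lra.
by rewrite !ler_wpM2l ?powR_ge0 ?(ltW K0).
Qed.

End SummingOperators.

(** * A Khinchin inequality with one sign vector for all columns, and the trace *)

Section KhinchinTrace.
Variable R : realType.

(** The expectation of the quartic minorant, with w = 1/s, at [t] plus a centred Gaussian of
    variance [v], whose fourth moment is 3 v^2. *)
Definition khinchin_potential (t v w : R) : R :=
  3 / 4 * ((t ^+ 2 + v) * w)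
  - (t ^+ 4 + 6 * (t ^+ 2 * v) + 3 * v ^+ 2) * w ^+ 3 / 16.

(* Method of conditional expectations: for random signs this potential is a
   submartingale when [t] is the partial signed sum and [v] the sum of squares
   of the remaining terms. *)
Lemma exists_signs_potential n m (Q : 'M[R]_(n, m)) (w : 'I_m -> R) (t : 'rV[R]_m) :
  (forall i, 0 <= w i) ->
  exists2 e : 'rV[R]_n, forall k, `|e ord0 k| = 1 &
    \sum_i khinchin_potential (t ord0 i) (\sum_k Q k i ^+ 2) (w i) <=
    \sum_i khinchin_potential ((t + e *m Q) ord0 i) 0 (w i).
Proof.
move=> w0; elim: n Q t => [|n IH] Q t.
  exists 0 => [[]//|]; rewrite mul0mx addr0.
  by under eq_bigr do rewrite big_ord0.
pose u := row ord0 Q.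
pose Q' : 'M[R]_(n, m) := row' ord0 Q.
have QE (c : R) (e : 'rV[R]_n) : (\row_k oapp (e ord0) c (unlift ord0 k)) *m Q
    = c *: u + e *m Q'.
  apply/rowP => i; rewrite !mxE big_ord_recl !mxE unlift_none/=; congr (_ + _).
  by apply: eq_bigr => k _; rewrite !mxE liftK.
have eE (c : R) (e : 'rV[R]_n) : `|c| = 1 -> (forall k, `|e ord0 k| = 1) ->
    forall k, `|(\row_k oapp (e ord0) c (unlift ord0 k)) ord0 k| = 1.
  by move=> c1 e1 k; rewrite mxE; case: unliftP => [j _|_] /=.
pose F (t : 'rV[R]_m) := \sum_i khinchin_potential (t ord0 i) (\sum_k Q' k i ^+ 2) (w i).
set G := \sum_i _.
have : 2 * G <= F (t + u) + F (t - u).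
  rewrite mulr_sumr -big_split/=; apply: ler_sum => i _.
  rewrite big_ord_recl [\sum_(k < n) Q (lift _ _) _ ^+ 2](_ : _ = \sum_k Q' k i ^+ 2);
    last by apply: eq_bigr => k _; rewrite !mxE.
  move: (\sum_k _) => v; rewrite !mxE.
  (* Averaging over the sign leaves the second moment unchanged and increases the potential by a
     quarter of this product. *)
  have : 0 <= Q ord0 i ^+ 4 * w i ^+ 3.
    by apply: mulr_ge0; [exact: exprn_even_ge0 | exact: exprn_ge0].
  by rewrite /khinchin_potential; lra.
have [GF _|FG GF] := leP G (F (t + u)).
  have [e e1 eF] := IH Q' (t + u).
  exists (\row_k oapp (e ord0) 1 (unlift ord0 k)); first by apply: eE; rewrite ?normr1.
  by rewrite QE scale1r addrA (le_trans GF).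
have {}GF : G <= F (t - u) by lra.
have [e e1 eF] := IH Q' (t - u).
exists (\row_k oapp (e ord0) (-1) (unlift ord0 k)).
  by apply: eE; rewrite ?normrN1.
by rewrite QE scaleN1r addrA (le_trans GF).
Qed.

(** With t = 0, v = sigma^2 and w = 1/sigma the potential is (3/4 - 3/16) sigma = 9/16 sigma.
    Summing it over the columns lets a single sign vector serve them all. *)
Lemma khinchin_signs n m (Q : 'M[R]_(n, m)) :
  exists2 e : 'rV[R]_n, forall k, `|e ord0 k| = 1 &
    9 / 16 * \sum_i Num.sqrt (\sum_k Q k i ^+ 2) <= \sum_i `|(e *m Q) ord0 i|.
Proof.
pose sg i := Num.sqrt (\sum_k Q k i ^+ 2).
have sg0 i : 0 <= sg i by exact: sqrtr_ge0.
have w0 i : 0 <= (sg i)^-1 by rewrite invr_ge0.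
have [e e1 He] := exists_signs_potential n m Q _ 0 w0.
exists e => //; apply: le_trans (le_trans He _).
  rewrite mulr_sumr le_eqVlt; apply/orP; left; apply/eqP/eq_bigr => i _.
  rewrite -/(sg i) -[X in khinchin_potential _ X]sqr_sqrtr; last first.
    by apply: sumr_ge0 => k _; exact: sqr_ge0.
  rewrite -/(sg i) /khinchin_potential mxE.
  have [->|s0] := eqVneq (sg i) 0; first by rewrite invr0; ring.
  by field.
apply: ler_sum => i _; rewrite add0r.
apply: le_trans (norm_ge_quartic R _ _ (sg0 i)).
rewrite /khinchin_potential invfM -exprVn le_eqVlt; apply/orP; left; apply/eqP.
by move: (sg i)^-1 => w; field.
Qed.

Lemma trace_le_signs n (Q P : 'M[R]_n) (a : R) : 0 < a ->
  Q *m P = 1%:M -> (forall i, \sum_k P i k ^+ 2 <= a ^+ 2) ->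
  exists2 e : 'rV[R]_n, forall k, `|e ord0 k| = 1 &
    n%:R <= 16 / 9 * (a * \sum_i `|(e *m Q) ord0 i|).
Proof.
move=> a0 QP Pa; have [e e1 He] := khinchin_signs n n Q; exists e => //.
apply: (@le_trans _ _ (a * \sum_i Num.sqrt (\sum_k Q k i ^+ 2))); last first.
  by have := ler_wpM2l (ltW a0) He; lra.
rewrite -[X in X <= _]mxtrace1 -QP /mxtrace.
under eq_bigr do rewrite mxE.
rewrite exchange_big mulr_sumr/=; apply: ler_sum => i _.
have S0 : 0 <= \sum_k Q k i ^+ 2 by apply: sumr_ge0 => k _; exact: sqr_ge0.
have := sqr_sqrtr S0; have := sqrtr_ge0 (\sum_k Q k i ^+ 2).
move: (Num.sqrt _) => s; rewrite le_eqVlt => /predU1P[<-|s0] sE.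
  rewrite mulr0 big1// => k _; suff -> : Q k i = 0 by rewrite mul0r.
  have /(psumr_eq0P (fun j _ => sqr_ge0 (Q j i)))/(_ k isT)/eqP : 
    \sum_k Q k i ^+ 2 = 0 by rewrite -sE expr0n.
  by rewrite sqrf_eq0 => /eqP.
(* Cauchy-Schwarz as a weighted AM-GM inequality; with these weights each half sums to at most a s /
   2. *)
apply: (@le_trans _ _ (\sum_k (a / s / 2 * Q k i ^+ 2 + s / a / 2 * P i k ^+ 2))).
  apply: ler_sum => k _.
  have : 0 <= (a * Q k i - s * P i k) ^+ 2 / (2 * (a * s)).
    by rewrite divr_ge0 ?sqr_ge0// ltW// !mulr_gt0.
  rewrite (_ : _ / _ = a / s / 2 * Q k i ^+ 2 + s / a / 2 * P i k ^+ 2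
     - Q k i * P i k); last by field; rewrite !gt_eqF.
  by lra.
rewrite big_split/= -!mulr_sumr -sE.
have : s / a / 2 * \sum_k P i k ^+ 2 <= s / a / 2 * a ^+ 2.
  by rewrite ler_wpM2l// !divr_ge0 ?ltW.
rewrite (_ : s / a / 2 * a ^+ 2 = a * s / 2); last by field; rewrite gt_eqF.
rewrite (_ : a / s / 2 * s ^+ 2 = a * s / 2); last by field; rewrite gt_eqF.
lra.
Qed.

End KhinchinTrace.

(** * Comparison and duality of l_p norms *)

Section LpNorms.
Variables (R : realType) (n : nat).
Implicit Types (x y : 'rV[R]_n) (p q : \bar R) (r s : R).

Lemma lpnorm_ge0 p x : 0 <= lpnorm p x.
Proof.
case: p => [p| |]/=; first exact: powR_ge0.
all: by elim/big_ind: _ => // a b a0 b0; rewrite le_max a0.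
Qed.

Lemma lpnorm_max x i : `|x ord0 i| <= \big[Num.max/0]_(i < n) `|x ord0 i|.
Proof. by rewrite (bigD1 i)//= le_max lexx. Qed.

Lemma lpnorm_powR r x : r != 0 ->
  (lpnorm r%:E x) `^ r = \sum_i `|x ord0 i| `^ r.
Proof.
move=> r0; rewrite /= -powRrM mulVf// powRr1//.
by apply: sumr_ge0 => i _; exact: powR_ge0.
Qed.

Lemma lpnormZ p t x : (1 <= p)%E -> 0 <= t ->
  lpnorm p (t *: x) = t * lpnorm p x.
Proof.
case: p => [p| |]//= p1 t0.
  rewrite lee_fin in p1; have p0 : p != 0 by rewrite gt_eqF//; lra.
  have S0 : 0 <= \sum_(i < n) `|x ord0 i| `^ p.
    by apply: sumr_ge0 => i _; exact: powR_ge0.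
  rewrite (eq_bigr (fun i => t `^ p * `|x ord0 i| `^ p)) => [|i _].
    by rewrite -mulr_sumr powRM ?powR_ge0// -powRrM mulfV// powRr1.
  by rewrite mxE normrM (ger0_norm t0) powRM.
rewrite (eq_bigr (fun i => t * `|x ord0 i|)) => [|i _]; last first.
  by rewrite mxE normrM (ger0_norm t0).
by rewrite (big_endo (fun u => t * u)) ?mulr0// => u v; rewrite maxr_pMr.
Qed.

Lemma coord_le_lpnorm p x i : (1 <= p)%E -> `|x ord0 i| <= lpnorm p x.
Proof.
case: p => [p| |] p1 //; last exact: lpnorm_max.
rewrite lee_fin in p1; have p0 : 0 < p by lra.
have pN0 : p != 0 by rewrite gt_eqF.
rewrite -[X in X <= _]powRr1// -(mulfV pN0) powRrM /=.
rewrite ge0_ler_powR ?invr_ge0 ?(ltW p0) ?nnegrE ?powR_ge0//.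
  by apply: sumr_ge0 => j _; exact: powR_ge0.
by rewrite (bigD1 i)//= lerDl sumr_ge0// => j _; exact: powR_ge0.
Qed.

(** Write |x_i|^r = |x_i|^p |x_i|^(r-p) and bound the second factor by the norm. *)
Lemma lpnorm_decr (p : R) r x : 1 <= p -> p <= r ->
  \sum_i `|x ord0 i| `^ r <= lpnorm p%:E x `^ r.
Proof.
move=> p1; rewrite le_eqVlt => /predU1P[<-|pr].
  by rewrite lpnorm_powR// gt_eqF//; lra.
have p0 : p != 0 by rewrite gt_eqF//; lra.
have addE u : 0 <= u -> u `^ r = u `^ p * u `^ (r - p).
  rewrite le_eqVlt => /predU1P[<-|u0]; last first.
    by rewrite -powRD ?(gt_eqF u0) ?implybT// subrKC.
  by rewrite !powR0 ?mul0r// gt_eqF//; lra.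
rewrite addE ?lpnorm_ge0// lpnorm_powR// mulr_suml; apply: ler_sum => i _.
rewrite addE// ler_wpM2l ?powR_ge0// ge0_ler_powR ?nnegrE ?lpnorm_ge0//; first by lra.
by apply: coord_le_lpnorm; rewrite lee_fin.
Qed.

Lemma sum_sqr_le_lpnorm p x : (1 <= p)%E -> (p <= 2%:E)%E ->
  \sum_i x ord0 i ^+ 2 <= lpnorm p x ^+ 2.
Proof.
case: p => [p| |]//; rewrite !lee_fin => p1 p2.
have := lpnorm_decr p 2 x p1 p2; rewrite powR_mulrn ?lpnorm_ge0//.
by under eq_bigr do rewrite powR_mulrn// real_normK ?num_real//.
Qed.

Lemma sum_sqr_le_lpnorm_dim p x : (1 <= n)%N -> (2%:E <= p)%E ->
  \sum_i x ord0 i ^+ 2 <=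
  (n%:R `^ (2^-1 - fine p^-1%E) * lpnorm p x) ^+ 2.
Proof.
move=> n1; have n0 : 0 < n%:R :> R by rewrite ltr0n.
case: p => [p| |]//.
  rewrite lee_fin => p2; have p0 : p != 0 by rewrite gt_eqF//; lra.
  rewrite fine_invr.
  set N := lpnorm p%:E x.
  have [N0|NN0] := eqVneq N 0.
    rewrite N0 mulr0 expr0n/= big1// => i _.
    have := coord_le_lpnorm p%:E x i; rewrite -/N N0 normr_le0 lee_fin => H.
    by rewrite (eqP (H _)) ?expr0n//; lra.
  have NE : N `^ p = \sum_i `|x ord0 i| `^ p by exact: lpnorm_powR.
  have Npos : 0 < N by rewrite lt0r NN0; exact: lpnorm_ge0.
  (* [c] is the p-th power mean of the coordinates, and the right side is n c^2. The tangent at 1 to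
     u^(p/2), taken at u = x_i^2 / c^2, is then summed over i. *)
  pose c := N * n%:R `^ (- p^-1).
  have c0 : 0 < c by apply: mulr_gt0 => //; exact: powR_gt0.
  have cE : c `^ p * n%:R = \sum_i `|x ord0 i| `^ p.
    rewrite -NE powRM ?powR_ge0 ?(ltW Npos)// -powRrM mulNr mulVf//.
    by rewrite powR_inv1 ?(ltW n0)// divfK// gt_eqF.
  rewrite exprMn -[X in X * _]powR_mulrn ?powR_ge0// -powRrM.
  rewrite mulrBl mulVf ?pnatr_eq0// powRB ?(gt_eqF n0) ?implybT// powRr1 ?(ltW n0)//.
  have -> : n%:R / n%:R `^ (p^-1 * 2) * N ^+ 2 = n%:R * c ^+ 2.
    rewrite powRrM powR_mulrn ?powR_ge0// /c powRN; field.
    by rewrite gt_eqF ?powR_gt0.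
  have p21 : 1 <= p / 2 by lra.
  have tangent i : (p / 2) * x ord0 i ^+ 2 <=
      (p / 2 - 1) * c ^+ 2 + `|x ord0 i| `^ p * (c ^+ 2 / c `^ p).
    have c20 : 0 < c ^+ 2 by rewrite exprn_gt0.
    have vE : (x ord0 i ^+ 2 / c ^+ 2) `^ (p / 2) = `|x ord0 i| `^ p / c `^ p.
      rewrite -expr_div_n -powR_sqr normf_div (gtr0_norm c0).
      by rewrite powRM ?invr_ge0 ?(ltW c0)// powRV ?(ltW c0).
    have := powR_tangent _ (p / 2) 1 (x ord0 i ^+ 2 / c ^+ 2) p21 ler01.
    rewrite divr_ge0 ?sqr_ge0// => /(_ isT); rewrite !powR1 mul1r mulr1 vE => H.
    have := ler_wpM2r (ltW c20) H; congr (_ <= _); last by ring.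
    by field; rewrite gt_eqF.
  have p20 : 0 < p / 2 by lra.
  rewrite -(ler_pM2l p20) mulr_sumr.
  apply: le_trans (ler_sum _ (fun i _ => tangent i)) _.
  rewrite big_split/= sumr_const card_ord -mulr_natr -mulr_suml -cE.
  rewrite le_eqVlt; apply/orP; left; apply/eqP; field.
  by rewrite gt_eqF ?powR_gt0.
rewrite invey subr0 => _.
rewrite exprMn -[X in X * _]powR_mulrn ?powR_ge0// -powRrM mulVf ?pnatr_eq0//.
rewrite powRr1 ?(ltW n0)//.
apply: (@le_trans _ _ (\sum_(i < n) lpnorm +oo%E x ^+ 2)).
  apply: ler_sum => i _; rewrite -real_normK ?num_real// lerXn2r ?nnegrE//.
    exact: lpnorm_ge0.
  by apply: coord_le_lpnorm; exact: leey.
by rewrite sumr_const card_ord mulr_natl.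
Qed.

Lemma lpnorm_signs q x : (1 <= n)%N -> (1 <= q)%E -> (forall i, `|x ord0 i| = 1) ->
  lpnorm q x <= n%:R `^ fine q^-1%E.
Proof.
move=> n1; case: q => [q| |]// q1 x1.
  rewrite fine_invr/=; under eq_bigr do rewrite x1 powR1.
  by rewrite sumr_const card_ord.
rewrite invey/= powRr0; elim/big_ind: _ => // [a b a1 b1|i _].
  by rewrite ge_max a1.
by rewrite x1.
Qed.

(** The transpose of an operator from l_q to l_1 maps l_oo to the dual l_s of l_q with no larger
    norm. *)
Lemma powsum_le_dual (q : R) s m (Q : 'M[R]_(n, m)) (D : R) : 1 < q -> 0 <= D ->
  q^-1 + s^-1 = 1 -> 0 < s ->
  (forall y, lpnorm q%:E y <= 1 -> \sum_i `|(y *m Q) ord0 i| <= D) ->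
  forall z, norm_le1 z -> powsum s (z *m Q^T) <= D `^ s.
Proof.
move=> q1 D0 qs s0 QD z z1; set v := z *m Q^T.
have := erefl (powsum s v); move: {2 3}(powsum s v) => V defV.
have q0 : 0 < q by lra.
have : 0 <= V by rewrite -defV; exact: powsum_ge0.
rewrite le_eqVlt => /predU1P[<-|V0]; first exact: powR_ge0.
have qs' : (s - 1) * q = s.
  have -> : q = (1 - s^-1)^-1 by rewrite -qs addrK invrK.
  have s1 : s - 1 != 0.
    apply/eqP => s1; have : q^-1 = 0 by rewrite (_ : s = 1) ?invr1 in qs; lra.
    by move/eqP; rewrite invr_eq0 gt_eqF.
  by field; rewrite gt_eqF//= s1.
(* The extremal vector in Hoelder's inequality for [v]: since (s - 1) q = s, its l_q norm is
   V^(1/q), while its pairing with [v] is V. *)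
pose y : 'rV[R]_n := \row_j (`|v ord0 j| `^ (s - 1) * Num.sg (v ord0 j)).
have yV : \sum_i z ord0 i * (y *m Q) ord0 i = V.
  rewrite -defV.
  under eq_bigr do rewrite mxE mulr_sumr.
  rewrite exchange_big/=; apply: eq_bigr => j _.
  rewrite (eq_bigr (fun i => y ord0 j * (z ord0 i * Q j i))) => [|i _]; last by ring.
  rewrite -mulr_sumr; have -> : \sum_i z ord0 i * Q j i = v ord0 j.
    by rewrite mxE; apply: eq_bigr => i _; rewrite mxE.
  by rewrite mxE -mulrA -normrEsg mulrC mulr_powRB1.
have yq : lpnorm q%:E y = V `^ q^-1.
  rewrite -defV /=; congr (_ `^ _); apply: eq_bigr => j _; rewrite mxE normrM.
  have [->|vj0] := eqVneq (v ord0 j) 0.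
    by rewrite normr0 sgr0 normr0 mulr0 !powR0 ?gt_eqF.
  by rewrite normr_sg vj0 mulr1 norm_powR// normr_id -powRrM qs'.
have a0 : 0 <= V `^ (- q^-1) by exact: powR_ge0.
have VD : V `^ (- q^-1) * V <= D.
  apply: le_trans (QD (V `^ (- q^-1) *: y) _); last first.
    have q1' : (1 <= q%:E)%E by rewrite lee_fin ltW.
    have Vq : V `^ q^-1 != 0 by rewrite gt_eqF// powR_gt0.
    by rewrite (lpnormZ _ _ _ q1' a0) yq powRN (mulVf Vq).
  rewrite -{2}yV mulr_sumr; apply: ler_sum => i _.
  rewrite -scalemxAl; move: (y *m Q) => u; rewrite mxE normrM ger0_norm// ler_wpM2l//.
  by apply: le_trans (ler_norm _) _; rewrite normrM ler_piMl.
have {}VD : V `^ s^-1 <= D.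
  have -> : s^-1 = - q^-1 + 1 by rewrite -qs addKr.
  by rewrite powRD ?(gt_eqF V0) ?implybT// powRr1 ?(ltW V0).
have -> : V = (V `^ s^-1) `^ s by rewrite -powRrM mulVf ?powRr1 ?(ltW V0) ?gt_eqF.
by rewrite ge0_ler_powR ?nnegrE ?powR_ge0// ltW.
Qed.

End LpNorms.

(** * From factorizations to matrices, and the trace bound *)

Section GammaReduction.
Variables (R : realType) (n : nat).
Hypothesis n1 : (1 <= n)%N.
Implicit Types (p q : \bar R).

Lemma lpnorm_le_sectionnorm p (E : {vspace 'rV[R]_n}) (x : subvs_of E) :
  (1 <= p)%E -> lpnorm p (vsval x) <= sectionnorm (@lpball R n p) x.
Proof.
move=> p1; rewrite /sectionnorm /ballnorm; apply: lb_le_inf.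
  (* The infimum needs a nonempty set; adding 1 keeps the scale positive at x = 0. *)
  pose t := lpnorm p (vsval x) + 1.
  have t0 : 0 < t by rewrite ltr_wpDl// lpnorm_ge0.
  exists t; split => //; exists (t^-1 *: x); last first.
    by rewrite scalerA mulfV ?gt_eqF// scale1r.
  rewrite /lpball/= lpnormZ ?invr_ge0 ?(ltW t0)// ler_pdivrMl// mulr1.
  by rewrite /t lerDl.
move=> t [t0 [y yK <-]]; rewrite linearZ lpnormZ ?(ltW t0)//.
by rewrite ler_piMr ?(ltW t0).
Qed.

Lemma sectionnorm_le1 p (E : {vspace 'rV[R]_n}) (x : subvs_of E) :
  lpnorm p (vsval x) <= 1 -> sectionnorm (@lpball R n p) x <= 1.
Proof.
move=> x1; apply: ge_inf; first by exists 0 => t [/ltW].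
by split => //; exists x; rewrite ?scale1r.
Qed.

(* An n-dimensional subspace of R^n is the whole space, so only matrices remain. *)
Lemma Gamma_ge p q (X : R) : (1 <= p)%E -> (1 <= q)%E -> 0 < X ->
  (forall (Q P : 'M[R]_n) (a D : R), Q *m P = 1%:M -> 0 < a -> 0 < D ->
    (forall j, lpnorm p (row j P) <= a) ->
    (forall x, lpnorm q x <= 1 -> \sum_i `|(x *m Q) ord0 i| <= D) ->
    X <= a * D) ->
  (X%:E <= Gamma n (@lpball R n p) (@lpball R n q))%E.
Proof.
move=> p1 q1 X0 XaD; apply: le_ereal_inf_tmp => _ [E [B [A [dimE AB ->]]]].
have Efull : E = fullv.
  by apply/eqP; rewrite eqEdim subvf dimE dimvf leq_eqVlt -[dim _]/(1 * n)%N mul1n eqxx.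
subst E; clear dimE.
set opA := opnorm _ _ A; set opB := opnorm _ _ B.
(* Matrices act on row vectors from the right, so A o B = id becomes Q P = 1. *)
pose Q : 'M[R]_n := lin1_mx (B \o vsproj fullv).
pose P : 'M[R]_n := lin1_mx (vsval \o A).
have QE x : x *m Q = B (vsproj fullv x) by rewrite mul_rV_lin1.
have PE x : x *m P = vsval (A x) by rewrite mul_rV_lin1.
have QP : Q *m P = 1%:M.
  apply/row_matrixP => i; rewrite !rowE mulmxA QE PE mulmx1.
  by rewrite -comp_lfunE AB id_lfunE vsprojK ?memvf.
pose i0 := Ordinal n1.
have opA_ge j : ((lpnorm p (row j P))%:E <= opA)%E.
  apply: le_ereal_sup_tmp; exists (sectionnorm (@lpball R n p) (A (delta_mx 0 j)))%:E.
    exists (delta_mx 0 j) => //=; rewrite (bigD1 j)//= big1 => [|k kj].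
      by rewrite mxE !eqxx addr0 normr1 powR1 powR1.
    by rewrite mxE (negPf kj) andbF normr0 powR0// oner_eq0.
  by rewrite lee_fin rowE PE lpnorm_le_sectionnorm.
pose a := \big[Num.max/0]_j lpnorm p (row j P).
have aP j : lpnorm p (row j P) <= a by rewrite /a (bigD1 j)//= le_max lexx.
have opA_a : (a%:E <= opA)%E.
  rewrite /a; elim/big_ind: _ => // [|u v u1 v1].
    by apply: le_trans (opA_ge i0); rewrite lee_fin lpnorm_ge0.
  by rewrite EFin_max ge_max u1.
(* Otherwise a column of [P] would vanish, against Q P = 1. *)
have a0 : 0 < a.
  rewrite ltNge; apply/negP => a0.
  suff : (Q *m P) i0 i0 = 0 by rewrite QP mxE eqxx => /eqP; rewrite oner_eq0.
  rewrite mxE big1// => k _; suff -> : P k i0 = 0 by rewrite mulr0.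
  apply/eqP; rewrite -normr_le0 (le_trans _ a0)// (le_trans _ (aP k))//.
  by have := coord_le_lpnorm R n p (row k P) i0 p1; rewrite mxE.
have opB_ge x : lpnorm q x <= 1 -> ((\sum_i `|(x *m Q) ord0 i|)%:E <= opB)%E.
  move=> x1; apply: le_ereal_sup_tmp.
  exists (lpnorm 1%:E (B (vsproj fullv x)))%:E.
    exists (vsproj fullv x) => //=; apply: sectionnorm_le1.
    by rewrite vsprojK ?memvf.
  rewrite lee_fin -QE /= invr1 powRr1.
    by rewrite ler_sum// => i _; rewrite powRr1.
  by rewrite sumr_ge0// => i _; exact: powR_ge0.
have opB0 : (0 <= opB)%E.
  apply: le_ereal_sup_tmp; exists (lpnorm 1%:E (B 0))%:E; last first.
    by rewrite lee_fin lpnorm_ge0.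
  exists 0 => //=; apply: sectionnorm_le1; rewrite linear0.
  by rewrite -(scale0r 0) lpnormZ// mul0r.
apply: (@le_trans _ _ (a%:E * opB)%E); last by rewrite lee_wpmul2r.
move: opB0 opB_ge; case: opB => [b| |]// b0 bP; last first.
  by rewrite gt0_muley ?lte_fin ?leey.
rewrite lee_fin in b0; rewrite -EFinM lee_fin.
(* If the norm of B were 0, every positive [D] would be allowed, and D = X/(2a) gives X <= X/2. *)
move: b0; rewrite le_eqVlt => /predU1P[b0|b0].
  have := XaD Q P a (X / (2 * a)) QP a0 _ aP.
  rewrite divr_gt0 ?mulr_gt0// => /(_ isT) H.
  have : X <= X / 2.
    rewrite -[X in _ <= X](_ : a * (X / (2 * a)) = _).
      apply: H => x x1; have := bP x x1; rewrite lee_fin -b0 => /le_trans; apply.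
      by rewrite divr_ge0 ?mulr_ge0 ?ltW.
    by field; rewrite gt_eqF.
  lra.
by apply: (XaD _ _ _ _ QP a0 b0 aP) => x x1; have := bP x x1; rewrite lee_fin.
Qed.

(** The sign vector of [trace_le_signs] has l_q norm at most n^(1/q), so it is mapped by [Q] to a
    vector of l_1 norm at most n^(1/q) D. *)
Lemma trace_lower_bound q (Q P : 'M[R]_n) (a D : R) : (1 <= q)%E ->
  0 < a -> Q *m P = 1%:M -> (forall i, \sum_k P i k ^+ 2 <= a ^+ 2) ->
  (forall x, lpnorm q x <= 1 -> \sum_i `|(x *m Q) ord0 i| <= D) ->
  9 / 16 * n%:R `^ (1 - fine q^-1%E) <= a * D.
Proof.
move=> q1 a0 QP Pa QD.
have n0 : 0 < n%:R :> R by rewrite ltr0n.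
have [e e1 ne] := trace_le_signs R n Q P a a0 QP Pa.
set k := fine q^-1%E; set t := n%:R `^ k.
have t0 : 0 < t by rewrite powR_gt0.
have : \sum_i `|(e *m Q) ord0 i| <= t * D.
  rewrite -ler_pdivrMl//.
  have : lpnorm q (t^-1 *: e) <= 1.
    rewrite lpnormZ ?invr_ge0 ?(ltW t0)// ler_pdivrMl// mulr1.
    exact: lpnorm_signs.
  move=> /QD; apply: le_trans; rewrite mulr_sumr ler_sum// => i _.
  by rewrite -scalemxAl; move: (e *m Q) => u; rewrite mxE normrM gtr0_norm ?invr_gt0.
move=> /(ler_wpM2l (ltW a0)) eD.
have {ne eD} : n%:R <= 16 / 9 * (a * (t * D)) by lra.
rewrite powRB ?(gt_eqF n0) ?implybT// powRr1 ?(ltW n0)// -/t.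
by move=> H; rewrite mulrA ler_pdivrMr//; lra.
Qed.

End GammaReduction.

Theorem theorem4p10 (R : realType) :
  (forall p q : \bar R, (1 <= p)%E -> (1 <= q)%E ->
     exists2 c : R, 0 < c & forall n : nat, (1 <= n)%N ->
       ((2%:E <= p)%E -> (2%:E <= q)%E ->
          ((c * n%:R `^ (2^-1 + fine (p^-1)%E - fine (q^-1)%E))%:E
             <= Gamma n (@lpball R n p) (@lpball R n q))%E) /\
       ((p <= 2%:E)%E ->
          ((c * n%:R `^ (1 - fine (q^-1)%E))%:E
             <= Gamma n (@lpball R n p) (@lpball R n q))%E))
  /\
  (forall (p q : \bar R) (r : R),
     (1 < q)%E -> (q <= 2%:E)%E -> (2%:E <= p)%E -> (p < +oo)%E ->
     (Order.max p (hoelder_conjugate q) < r%:E)%E ->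
     exists2 c : R, 0 < c & forall n : nat, (1 <= n)%N ->
       ((c * n%:R `^ r^-1)%:E <= Gamma n (@lpball R n p) (@lpball R n q))%E).
Proof.
split => [p q p1 q1|].
  exists (9 / 16) => [|n n1]; first by lra.
  have n0 : 0 < n%:R :> R by rewrite ltr0n.
  split => [p2 _|p2].
    apply: Gamma_ge => //; first by rewrite mulr_gt0 ?powR_gt0//; lra.
    move=> Q P a D QP a0 D0 Pa QD.
    (* The rows of [P] have Euclidean norm at most n^b a, and (1 - 1/q) - b is the required
       exponent. *)
    set b := 2^-1 - fine p^-1%E.
    have nb0 : 0 < n%:R `^ b by rewrite powR_gt0.
    have := trace_lower_bound R n n1 q Q P (n%:R `^ b * a) D q1 (mulr_gt0 nb0 a0) QP.
    move=> /(_ _ QD) H; rewrite -(ler_pM2l nb0) [X in _ <= X]mulrA.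
    apply: le_trans _ (H _) => [|i].
      rewrite mulrCA ler_pM2l ?divr_gt0// -powRD ?(gt_eqF n0) ?implybT//.
      by rewrite le_eqVlt /b; apply/orP; left; apply/eqP; congr (_ `^ _); field.
    have := sum_sqr_le_lpnorm_dim R n p (row i P) n1 p2.
    under eq_bigr do rewrite mxE.
    move=> /le_trans; apply.
    rewrite lerXn2r ?nnegrE ?mulr_ge0 ?powR_ge0 ?lpnorm_ge0 ?(ltW a0)//.
    by rewrite ler_pM2l.
  apply: Gamma_ge => //; first by rewrite mulr_gt0 ?powR_gt0//; lra.
  move=> Q P a D QP a0 D0 Pa QD.
  apply: (trace_lower_bound _ _ n1 _ _ _ _ _ q1 a0 QP) => // i.
  have := sum_sqr_le_lpnorm R n p (row i P) p1 p2.
  under eq_bigr do rewrite mxE.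
  by move=> /le_trans; apply; rewrite lerXn2r ?nnegrE ?lpnorm_ge0 ?(ltW a0).
move=> [p| |]// [q| |]// r; rewrite lte_fin !lee_fin => q1 q2 p2 _.
have q0 : q != 0 by rewrite gt_eqF//; lra.
have [qV1 qV2] : 2^-1 <= q^-1 /\ q^-1 < 1.
  have q_gt0 : 0 < q by lra.
  by rewrite lef_pV2 ?posrE ?invf_lt1.
(* The conjugate exponent of [q]; it is at least 2 because q <= 2. *)
pose s := (1 - q^-1)^-1.
have -> : hoelder_conjugate q%:E = s%:E.
  have q_neq1 : q - 1 != 0 by rewrite gt_eqF// subr_gt0.
  rewrite /hoelder_conjugate/= (_ : (_ == _) = false); last exact/negbTE.
  rewrite -EFinD inver (negPf q_neq1) -EFinM /s; congr EFin; field.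
  by rewrite q0 q_neq1.
rewrite -EFin_max lte_fin gt_max => /andP[pr sr].
have qs : q^-1 + s^-1 = 1 by rewrite /s invrK; ring.
have s2 : 2 <= s.
  have d0 : 0 < 1 - q^-1 by lra.
  by rewrite /s -[2]invrK lef_pV2 ?posrE ?invr_gt0//; lra.
have s0 : 0 < s by lra.
have r0 : 0 < r by lra.
have [C C0 CP] := summing_identity R s r s2 sr.
have c0 : 0 < C `^ (- r^-1) by rewrite powR_gt0.
exists (C `^ (- r^-1)) => // n n1.
have n0 : 0 < n%:R :> R by rewrite ltr0n.
apply: Gamma_ge => //.
- by rewrite lee_fin; lra.
- by rewrite lee_fin ltW.
- by rewrite mulr_gt0 ?powR_gt0.
move=> Q P a D QP a0 D0 Pa QD.
have aD0 : 0 < a * D by rewrite mulr_gt0.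
have := CP n Q^T P^T D a D0 (ltW a0).
rewrite -trmx_mul QP trmx1 => /(_ erefl) H.
have {H} : n%:R <= C * (a * D) `^ r.
  apply: H => [|i].
    exact: (powsum_le_dual R n q s n Q D q1 (ltW D0) qs s0 QD).
  under eq_bigr do rewrite mxE.
  have p1 : 1 <= p by lra.
  rewrite (eq_bigr (fun k => `|row i P ord0 k| `^ r)) => [|k _]; last by rewrite mxE.
  (* Here r > p enters: the l_p bound on the rows of [P] also bounds their l_r norms. *)
  apply: le_trans (lpnorm_decr R n p r (row i P) p1 (ltW pr)) _.
  by rewrite ge0_ler_powR ?nnegrE ?lpnorm_ge0 ?(ltW a0) ?(ltW r0).
rewrite -ler_pdivrMl// => H.
have -> : C `^ (- r^-1) * n%:R `^ r^-1 = (C^-1 * n%:R) `^ r^-1.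
  by rewrite powRM ?invr_ge0 ?(ltW C0) ?(ltW n0)// powRV ?(ltW C0)// powRN.
have aDE : ((a * D) `^ r) `^ r^-1 = a * D.
  by rewrite -powRrM mulfV ?powRr1 ?(ltW aD0) ?(gt_eqF r0).
have Cn : 0 <= C^-1 * n%:R by rewrite mulr_ge0 ?invr_ge0 ?(ltW C0).
by rewrite -[X in _ <= X]aDE ge0_ler_powR ?nnegrE ?powR_ge0 ?invr_ge0 ?(ltW r0).
Qed.
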